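(* Let $\Lambda$ be any qubit channel whose Choi state has rank one. If one half of the Bell state $|\Phi_1\rangle=\frac{1}{\sqrt2}(|00\rangle+|11\rangle)$ is sent through $\Lambda$, then the final shared state $(\mathbf I\otimes\Lambda)(|\Phi_1\rangle\langle\Phi_1|)$ is useful for universal quantum teleportation (UQT).
   Context: A qubit channel is a completely positive trace-preserving linear map $\Lambda$ on $2\times2$ complex matrices. Its Choi state is $\rho_{\Lambda,\Phi_1}=(\mathbf I\otimes\Lambda)(|\Phi_1\rangle\langle\Phi_1|)$. If Alice prepares a two-qubit state $\rho$ and sends one half (the second qubit) through $\Lambda$, the final shared state is $(\mathbf I\otimes\Lambda)(\rho)$. Useful for UQT. For a two-qubit density matrix $\rho$ let $T_\rho$ be the real $3\times3$ matrix with entries $T_{ij}=\mathrm{Tr}(\rho\,\sigma_i\otimes\sigma_j)$ ($\sigma_1,\sigma_2,\sigma_3$ the Pauli matrices). By local unitaries $\rho$ can be brought to a canonical form $\rho_C$ with diagonal correlation matrix $\mathrm{diag}(\tau_1,\tau_2,\tau_3)$, $\tau_k=\lambda_k|t_{kk}|$, $\lambda_k\in\{\pm1\}$, where $|t_{11}|,|t_{22}|,|t_{33}|$ are the singular values of $T_\rho$; if $\det T_\rho\le 0$ all $\lambda_k=-1$, and if $\det T_\rho>0$ the $\lambda_k$ equal $-1$ for the two largest $|t_{kk}|$ and $+1$ for the smallest. The maximal average fidelity $F_\rho$ is the average teleportation fidelity (over uniformly distributed pure qubit inputs, standard teleportation protocol, maximized over local unitaries), attained by $\rho_C$, and the fidelity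 deviation $\Delta_\rho$ is the standard deviation over inputs of the fidelity when $\rho_C$ is used; explicitly $F_\rho=\frac12\bigl(1-\frac13\sum_k\tau_k\bigr)$ and $\Delta_\rho=\frac{1}{3\sqrt{10}}\sqrt{\sum_{i<j}(\tau_i-\tau_j)^2}$. The state $\rho$ is useful for UQT if $F_\rho>\frac23$ and $\Delta_\rho=0$; equivalently, $\det T_\rho<0$ and $|t_{11}|=|t_{22}|=|t_{33}|>\frac13$. *)

(* Defs.v *)
From HB Require Import structures.
From mathcomp Require Import all_boot all_order all_algebra.
From mathcomp Require Import complex mxtens.
From mathcomp Require Import all_classical all_reals all_analysis.

Set Implicit Arguments.
Unset Strict Implicit.
Unset Printing Implicit Defensive.

Import Order.TTheory GRing.Theory Num.Theory.
Import numFieldNormedType.Exports.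
Local Open Scope classical_set_scope.
Local Open Scope ring_scope.
Local Open Scope complex_scope.

Section Qubits.
Variable R : realType.
Local Notation C := R[i].

Definition adjmx {m n} (A : 'M[C]_(m, n)) : 'M[C]_(n, m) := map_mx conjc A^T.

Definition ketbra {n} (v : 'cV[C]_n) : 'M[C]_n := v *m adjmx v.

(* In [R[i]] the relation [0 <= z] says that [z] is real and nonnegative, so
   this condition entails that [A] is Hermitian. *)
Definition psdmx {n} (A : 'M[C]_n) : Prop :=
  forall v : 'cV[C]_n, 0 <= (adjmx v *m A *m v) 0 0.

Definition unitary {n} (U : 'M[C]_n) : Prop := U *m adjmx U = 1%:M.

Definition sub_block {k n} (A : 'M[C]_(k * n)) (a b : 'I_k) : 'M[C]_n :=
  \matrix_(i, j) A (mxtens_index (a, i)) (mxtens_index (b, j)).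

(* [A = \sum_(a, b) |a><b| (x) sub_block A a b]; the map acts on the second
   tensor factor. *)
Definition id_tens (k : nat) {n} (L : 'M[C]_n -> 'M[C]_n) (A : 'M[C]_(k * n)) :
    'M[C]_(k * n) :=
  \sum_(a < k) \sum_(b < k) delta_mx a b *t L (sub_block A a b).

Definition completely_positive (L : 'M[C]_2 -> 'M[C]_2) : Prop :=
  forall (k : nat) (A : 'M[C]_(k * 2)), psdmx A -> psdmx (id_tens L A).

Definition trace_preserving (L : 'M[C]_2 -> 'M[C]_2) : Prop :=
  forall A : 'M[C]_2, \tr (L A) = \tr A.

Definition qubit_channel (L : {linear 'M[C]_2 -> 'M[C]_2}) : Prop :=
  completely_positive L /\ trace_preserving L.

Definition ket (a b : 'I_2) : 'cV[C]_(2 * 2) := delta_mx (mxtens_index (a, b)) 0.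

Definition Phi1 : 'cV[C]_(2 * 2) :=
  ((Num.sqrt 2)^-1)%:C *: (ket 0 0 + ket 1 1).

Definition singlet : 'cV[C]_(2 * 2) :=
  ((Num.sqrt 2)^-1)%:C *: (ket 0 1 - ket 1 0).

Definition choi_state (L : 'M[C]_2 -> 'M[C]_2) : 'M[C]_(2 * 2) :=
  id_tens L (ketbra Phi1).

Definition mx22 (a b c d : C) : 'M[C]_2 :=
  \matrix_(i, j) if i == 0 then (if j == 0 then a else b)
                 else (if j == 0 then c else d).

Definition pauli (k : 'I_4) : 'M[C]_2 :=
  match val k with
  | 0 => 1%:M
  | 1 => mx22 0 1 1 0
  | 2 => mx22 0 (- 'i%C) 'i%C 0
  | _ => mx22 1 0 0 (-1)
  end.

Definition sigma (i : 'I_3) : 'M[C]_2 := pauli (lift ord0 i).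

(* The traces are real for Hermitian [rho]. *)
Definition corr_mx (rho : 'M[C]_(2 * 2)) : 'M[R]_3 :=
  \matrix_(i, j) complex.Re (\tr (rho *m (sigma i *t sigma j))).

Definition local_conj (U V : 'M[C]_2) (rho : 'M[C]_(2 * 2)) : 'M[C]_(2 * 2) :=
  (U *t V) *m rho *m adjmx (U *t V).

Definition ptrace1 {m n} (A : 'M[C]_(m * n)) : 'M[C]_n :=
  \sum_(a < m) sub_block A a a.

(* The four projectors of the Bell measurement; [k = 0] is the singlet. *)
Definition bell_proj (k : 'I_4) : 'M[C]_(2 * 2) :=
  ketbra ((pauli k *t 1%:M) *m singlet).

(* Bob's unnormalised state after outcome [k] of the Bell measurement of the
   input qubit together with the first qubit of [rho]. *)
Definition bob_state (rho : 'M[C]_(2 * 2)) (psi : 'cV[C]_2) (k : 'I_4) :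
    'M[C]_2 :=
  ptrace1 ((bell_proj k *t 1%:M) *m
           castmx (mulnA 2 2 2, mulnA 2 2 2) (ketbra psi *t rho)).

(* Standard protocol with the singlet as the reference resource: on outcome [k]
   Bob applies [pauli k], so for a state [fidelity rho psi] is
   [(1 - \sum_i T i i * n_i ^+ 2) / 2] for [psi] with Bloch vector [n], where
   [T = corr_mx rho].  The sum over [k] is the expected fidelity, the outcome
   probabilities being carried by [bob_state]. *)
Definition fidelity (rho : 'M[C]_(2 * 2)) (psi : 'cV[C]_2) : R :=
  complex.Re (\sum_(k < 4)
    (adjmx psi *m (pauli k *m bob_state rho psi k *m adjmx (pauli k))
       *m psi) 0 0).

Definition bloch (theta phi : R) : 'cV[C]_2 :=
  \col_i if i == 0 then (cos (theta / 2))%:C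
         else (cos phi +i* sin phi) * (sin (theta / 2))%:C.

(* Mean over uniformly distributed pure inputs: [sin theta dtheta dphi / 4 pi]
   on the Bloch sphere. *)
Definition mean_pure (g : 'cV[C]_2 -> R) : R :=
  (4 * pi)^-1 *
  \int[@lebesgue_measure R]_(phi in `[0, 2 * pi])
    \int[@lebesgue_measure R]_(theta in `[0, pi])
      (g (bloch theta phi) * sin theta).

Definition avg_fidelity (rho : 'M[C]_(2 * 2)) : R := mean_pure (fidelity rho).

Definition sd_fidelity (rho : 'M[C]_(2 * 2)) : R :=
  Num.sqrt (mean_pure (fun psi => (fidelity rho psi - avg_fidelity rho) ^+ 2)).

Definition max_avg_fidelity (rho : 'M[C]_(2 * 2)) : R :=
  sup [set F | exists U V : 'M[C]_2,
    [/\ unitary U, unitary V & F = avg_fidelity (local_conj U V rho)]].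

(* The squares of the singular values are the eigenvalues of [T^T T], with
   multiplicity. *)
Definition singular_values (T : 'M[R]_3) (t : 'I_3 -> R) : Prop :=
  (forall k, 0 <= t k) /\
  char_poly (T^T *m T) = \prod_(k < 3) ('X - (t k ^+ 2)%:P).

Definition canonical_signs (T : 'M[R]_3) (t lambda : 'I_3 -> R) : Prop :=
  if \det T <= 0 then forall k, lambda k = -1
  else exists m : 'I_3, (forall k, t m <= t k) /\
         (forall k, lambda k = if k == m then 1 else -1).

Definition is_canonical_form (rho rhoC : 'M[C]_(2 * 2)) : Prop :=
  (exists U V : 'M[C]_2,
     [/\ unitary U, unitary V & rhoC = local_conj U V rho]) /\
  (exists t lambda : 'I_3 -> R,
     [/\ singular_values (corr_mx rho) t,
         canonical_signs (corr_mx rho) t lambda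
       & corr_mx rhoC = diag_mx (\row_k (lambda k * t k))]).

(* [fidelity] depends on the state only through its correlation matrix, and
   canonical forms of [rho] differ there by a permutation of the diagonal, so the
   choice is immaterial for [fidelity_deviation].  Every state has a canonical
   form; the default value [rho] of [xget] plays no role. *)
Definition canonical_form (rho : 'M[C]_(2 * 2)) : 'M[C]_(2 * 2) :=
  xget rho [set rhoC | is_canonical_form rho rhoC].

Definition fidelity_deviation (rho : 'M[C]_(2 * 2)) : R :=
  sd_fidelity (canonical_form rho).

Definition useful_for_UQT (rho : 'M[C]_(2 * 2)) : Prop :=
  2 / 3 < max_avg_fidelity rho /\ fidelity_deviation rho = 0.

End Qubits.

Arguments Phi1 {R}.
Arguments singlet {R}.

(* Main.v *)
(** A Choi state of rank one is positive, hence a projector [ketbra w] up to a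
    positive factor absorbed in [w]; trace preservation makes the 2x2 matrix of
    amplitudes of [w] a multiple of a unitary.  Dropping a global phase, this
    matrix is [[p, q], [-q^*, p^*]] with |p|^2 + |q|^2 = 1/2, so the final state
    is a local rotation of the singlet and its correlation matrix is orthogonal of
    determinant -1: all singular values are 1 and all signs are -1.  Since the
    teleportation fidelity at Bloch vector n is (tr rho - \sum_i T_ii n_i^2) / 2,
    a canonical form teleports every input with fidelity 1; hence zero deviation,
    and average fidelity 1 is attained in the supremum, which is bounded because
    T_ii >= -1 for pure states. *)

Require Import Defs.
From HB Require Import structures.
From mathcomp Require Import all_boot all_order all_algebra.
From mathcomp Require Import complex mxtens.
From mathcomp Require Import all_classical all_reals all_analysis.
From mathcomp Require Import ring lra.

Import Order.TTheory GRing.Theory Num.Theory.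
Import numFieldNormedType.Exports.
Local Open Scope ring_scope.
Local Open Scope complex_scope.

(** * Sums, adjoints and Pauli matrices in coordinates *)

Lemma sum_mxtens (V : nmodType) m n (F : 'I_(m * n) -> V) :
  \sum_k F k = \sum_i \sum_j F (mxtens_index (i, j)).
Proof.
rewrite pair_big (reindex (@mxtens_index m n)) /=; last first.
  by exists (@mxtens_unindex m n) => k _; rewrite (mxtens_indexK, mxtens_unindexK).
by apply: eq_bigr => -[].
Qed.

Section RankOneChoi.
Variable R : realType.
Local Notation C := R[i].
Local Notation o3 k := (@Ordinal 3 k isT).
Local Notation o4 k := (@Ordinal 4 k isT).
Implicit Types (rho : 'M[C]_(2 * 2)) (psi : 'cV[C]_2).

Lemma adjmxE m n (A : 'M[C]_(m, n)) i j : adjmx A i j = conjc (A j i).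
Proof. by rewrite !mxE. Qed.

Lemma ketbraE n (v : 'cV[C]_n) i j : ketbra v i j = v i 0 * conjc (v j 0).
Proof. by rewrite mxE big_ord1 adjmxE. Qed.

Lemma adjmxM m n p (A : 'M[C]_(m, n)) (B : 'M[C]_(n, p)) :
  adjmx (A *m B) = adjmx B *m adjmx A.
Proof. by rewrite /adjmx trmx_mul map_mxM. Qed.

Lemma adjmxK m n (A : 'M[C]_(m, n)) : adjmx (adjmx A) = A.
Proof. by apply/matrixP => i j; rewrite !adjmxE conjcK. Qed.

Lemma ord2P (P : 'I_2 -> Prop) : P 0 -> P 1 -> forall i, P i.
Proof.
move=> P0 P1 [[|[|//]] hi].
  by rewrite (_ : Ordinal hi = 0) //; exact: val_inj.
by rewrite (_ : Ordinal hi = 1) //; exact: val_inj.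
Qed.

Lemma ord3P (P : 'I_3 -> Prop) : P (o3 0) -> P (o3 1) -> P (o3 2) ->
  forall i, P i.
Proof.
move=> P0 P1 P2 [[|[|[|//]]] hi].
- by rewrite (_ : Ordinal hi = o3 0) //; exact: val_inj.
- by rewrite (_ : Ordinal hi = o3 1) //; exact: val_inj.
- by rewrite (_ : Ordinal hi = o3 2) //; exact: val_inj.
Qed.

Lemma sum2 (V : nmodType) (F : 'I_2 -> V) : \sum_i F i = F 0 + F 1.
Proof. by rewrite (big_ord_recl 1) big_ord1; congr (F _ + F _); exact: val_inj. Qed.

Lemma sum3 (V : nmodType) (F : 'I_3 -> V) :
  \sum_i F i = F (o3 0) + F (o3 1) + F (o3 2).
Proof.
rewrite 2!big_ord_recr big_ord1 /=.
by do !congr (_ + _); congr F; exact: val_inj.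
Qed.

Lemma sum4 (V : nmodType) (F : 'I_4 -> V) :
  \sum_i F i = F (o4 0) + F (o4 1) + F (o4 2) + F (o4 3).
Proof.
rewrite 3!big_ord_recr big_ord1 /=.
by do !congr (_ + _); congr F; exact: val_inj.
Qed.

Lemma mx22E (a b c d : C) :
  ((mx22 a b c d 0 0 = a) * (mx22 a b c d 0 1 = b) *
   (mx22 a b c d 1 0 = c) * (mx22 a b c d 1 1 = d))%type.
Proof. by rewrite !mxE. Qed.

Lemma pauliE :
  ((pauli R (o4 0) = mx22 1 0 0 1) *
   (pauli R (o4 1) = mx22 0 1 1 0) *
   (pauli R (o4 2) = mx22 0 (- 'i%C) 'i%C 0) *
   (pauli R (o4 3) = mx22 1 0 0 (-1)))%type.
Proof.
split; last by []; split; last by []; split; last by [].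
by apply/matrixP => -[[|[|//]] ?] [[|[|//]] ?]; rewrite !mxE.
Qed.

Lemma sigmaE :
  ((sigma R (o3 0) = mx22 0 1 1 0) *
   (sigma R (o3 1) = mx22 0 (- 'i%C) 'i%C 0) *
   (sigma R (o3 2) = mx22 1 0 0 (-1)))%type.
Proof. by []. Qed.

Lemma conjcM (x y : C) : conjc (x * y) = conjc x * conjc y.
Proof. exact: rmorphM. Qed.

Lemma conjcN (x : C) : conjc (- x) = - conjc x.
Proof. exact: rmorphN. Qed.

Lemma conjcD (x y : C) : conjc (x + y) = conjc x + conjc y.
Proof. exact: rmorphD. Qed.

Lemma conjci : conjc 'i%C = - 'i%C :> C.
Proof. by apply/eqP; rewrite eq_complex /= oppr0 !eqxx. Qed.

Lemma invsqrt2_sqr : ((Num.sqrt 2 : R)^-1)%:C * ((Num.sqrt 2 : R)^-1)%:C = 2^-1 :> C.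
Proof. by rewrite -rmorphM -invfM -expr2 sqr_sqrtr// fmorphV rmorphMn. Qed.

(** * The teleportation protocol in coordinates *)

Lemma singletE :
  ((@singlet R (mxtens_index (0, 0)) 0 = 0) *
   (@singlet R (mxtens_index (0, 1)) 0 = ((Num.sqrt 2)^-1)%:C) *
   (@singlet R (mxtens_index (1, 0)) 0 = - ((Num.sqrt 2)^-1)%:C) *
   (@singlet R (mxtens_index (1, 1)) 0 = 0))%type.
Proof. by do ?split; rewrite !mxE /= ?subr0 ?sub0r ?mulr0 ?mulr1 ?mulrN1. Qed.

Lemma bell_ketE k (a b : 'I_2) :
  ((pauli R k *t 1%:M) *m singlet) (mxtens_index (a, b)) 0 =
  ((Num.sqrt 2)^-1)%:C * (if b == 0 then - pauli R k a 1 else pauli R k a 0).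
Proof.
rewrite mxE sum_mxtens !sum2 !tensmxE !singletE !mxE.
by case: b => [[|[|//]] ?] /=; ring.
Qed.

Lemma bell_projE k (a b c d : 'I_2) :
  bell_proj R k (mxtens_index (a, b)) (mxtens_index (c, d)) =
  2^-1 * ((if b == 0 then - pauli R k a 1 else pauli R k a 0) *
    conjc (if d == 0 then - pauli R k c 1 else pauli R k c 0)).
Proof.
by rewrite ketbraE !bell_ketE conjcM conjc_real mulrACA invsqrt2_sqr.
Qed.

Lemma mxtrace_tens rho :
  \tr rho = \sum_(a < 2) \sum_(i < 2) rho (mxtens_index (a, i)) (mxtens_index (a, i)).
Proof. exact: sum_mxtens. Qed.

Lemma mxtrace_tensmx rho (A B : 'M[C]_2) :
  \tr (rho *m (A *t B)) = \sum_(a < 2) \sum_(i < 2) \sum_(b < 2) \sum_(j < 2)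
    rho (mxtens_index (a, i)) (mxtens_index (b, j)) * (A b a * B j i).
Proof.
rewrite /mxtrace sum_mxtens; apply: eq_bigr => a _; apply: eq_bigr => i _.
rewrite mxE sum_mxtens; apply: eq_bigr => b _; apply: eq_bigr => j _.
by rewrite tensmxE.
Qed.

Lemma mulmx22E (A B : 'M[C]_2) i j : (A *m B) i j = A i 0 * B 0 j + A i 1 * B 1 j.
Proof. by rewrite mxE sum2. Qed.

Lemma sandwichE psi (A : 'M[C]_2) : (adjmx psi *m A *m psi) 0 0 =
  (conjc (psi 0 0) * A 0 0 + conjc (psi 1 0) * A 1 0) * psi 0 0 +
  (conjc (psi 0 0) * A 0 1 + conjc (psi 1 0) * A 1 1) * psi 1 0.
Proof. by rewrite mxE sum2 !mxE !sum2 !adjmxE. Qed.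

Lemma bob_stateE rho psi k i j :
  bob_state rho psi k i j = \sum_(a2 < 2) \sum_(b2 < 2)
    (\sum_(a1 < 2) \sum_(b1 < 2)
       bell_proj R k (mxtens_index (a1, a2)) (mxtens_index (b1, b2)) *
       (psi b1 0 * conjc (psi a1 0))) *
    rho (mxtens_index (b2, i)) (mxtens_index (a2, j)).
Proof.
rewrite /bob_state; move: (bell_proj R k) => P.
(* Both bracketings of three qubits give a basis vector the same number. *)
have castE (x y z : 'I_2) : cast_ord (esym (mulnA 2 2 2))
    (mxtens_index (mxtens_index (x, y), z)) = mxtens_index (x, mxtens_index (y, z)).
  by apply: val_inj; rewrite /= mulnDl -mulnA addnA.
rewrite summxE sum_mxtens exchange_big; apply: eq_bigr => a2 _ /=.
under [RHS]eq_bigr do rewrite mulr_suml; rewrite [RHS]exchange_big.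
apply: eq_bigr => a1 _ /=; rewrite !mxE !sum_mxtens.
under [RHS]eq_bigr do rewrite mulr_suml; rewrite [RHS]exchange_big.
apply: eq_bigr => b1 _; apply: eq_bigr => b2 _.
rewrite (bigD1 i) //= big1 => [|l /negPf li]; last first.
  by rewrite tensmxE mxE eq_sym li mulr0 mul0r.
by rewrite addr0 tensmxE castmxE /= !castE tensmxE ketbraE mxE eqxx mulr1 mulrA.
Qed.

(* Projecting on the singlet contracts Alice's qubit with [chi], which is [phi]
   turned by the antisymmetric form. *)
Lemma bob_state_flipE rho psi k i j :
  let phi := adjmx (pauli R k) *m psi in
  let chi (b : 'I_2) := if b == 0 then - phi 1 0 else phi 0 0 in
  bob_state rho psi k i j = 2^-1 * \sum_(a < 2) \sum_(b < 2)
    chi b * conjc (chi a) * rho (mxtens_index (b, i)) (mxtens_index (a, j)).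
Proof.
move=> phi chi; rewrite bob_stateE mulr_sumr.
apply: eq_bigr => a _; rewrite mulr_sumr; apply: eq_bigr => b _.
rewrite [RHS]mulrA; congr (_ * _).
rewrite !sum2 !bell_projE /chi !mxE !sum2 !adjmxE.
move: (psi 0 0) (psi 1 0) (pauli R k) 2^-1 => p q P h.
by case: (a == 0); case: (b == 0); rewrite !(conjcD, conjcM, conjcN, conjcK); ring.
Qed.

(** The outer Pauli matrices are moved onto [psi], so measurement and correction both act through
    one turned input [(p, q)]. Abstract [p] and [q] delay the expansion of the Pauli entries. *)
Lemma outcome_fidelityE rho psi k (p q : C) :
  let r (a i b j : 'I_2) := rho (mxtens_index (a, i)) (mxtens_index (b, j)) in
  (adjmx (pauli R k) *m psi) 0 0 = p -> (adjmx (pauli R k) *m psi) 1 0 = q ->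
  (adjmx psi *m (pauli R k *m bob_state rho psi k *m adjmx (pauli R k)) *m psi) 0 0
  = 2^-1 *
  ((conjc p * (q * conjc q * r 0 0 0 0 - p * conjc q * r 1 0 0 0
       - q * conjc p * r 0 0 1 0 + p * conjc p * r 1 0 1 0)
   + conjc q * (q * conjc q * r 0 1 0 0 - p * conjc q * r 1 1 0 0
       - q * conjc p * r 0 1 1 0 + p * conjc p * r 1 1 1 0)) * p
  + (conjc p * (q * conjc q * r 0 0 0 1 - p * conjc q * r 1 0 0 1
       - q * conjc p * r 0 0 1 1 + p * conjc p * r 1 0 1 1)
   + conjc q * (q * conjc q * r 0 1 0 1 - p * conjc q * r 1 1 0 1
       - q * conjc p * r 0 1 1 1 + p * conjc p * r 1 1 1 1)) * q).
Proof.
move=> r pE qE; rewrite !mulmxA -[_ *m adjmx _ *m psi]mulmxA.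
rewrite -[adjmx psi *m pauli R k]adjmxK adjmxM adjmxK sandwichE.
rewrite !bob_state_flipE pE qE !sum2 /= !conjcN /r.
by ring.
Qed.

Lemma adj_pauli_ket psi (k : 'I_4) i : (adjmx (pauli R k) *m psi) i 0 =
   conjc (pauli R k 0 i) * psi 0 0 + conjc (pauli R k 1 i) * psi 1 0.
Proof. by rewrite mxE sum2 !adjmxE. Qed.

(** A polynomial identity in the entries of [rho], those of [psi] and the conjugates of the latter,
    taken as independent; the one relation used is that ['i%C] squares to -1. *)
Lemma fidelity_sumE rho psi :
  \sum_(k < 4)
    (adjmx psi *m (pauli R k *m bob_state rho psi k *m adjmx (pauli R k)) *m psi) 0 0
  = 2^-1 * ((adjmx psi *m psi) 0 0 ^+ 2 * \tr rho -
     \sum_(i < 3) \tr (rho *m (sigma R i *t sigma R i)) *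
        (adjmx psi *m sigma R i *m psi) 0 0 ^+ 2).
Proof.
rewrite sum4 sum3 mxtrace_tens !mxtrace_tensmx.
rewrite !(outcome_fidelityE _ _ _ _ _ (adj_pauli_ket _ _ _) (adj_pauli_ket _ _ _)).
rewrite !sandwichE !sum2 [(adjmx psi *m psi) 0 0]mxE sum2 !adjmxE.
rewrite !pauliE !sigmaE !mx22E.
rewrite ?(conjcD, conjcM, conjcN, conjc0, conjc1, conjci, conjcK).
have I2 : 'i%C * 'i%C = -1 :> C := sqr_i R.
move: (psi 0 0) (psi 1 0) 2^-1 'i%C I2 => p q h I I2.
by ring: I2.
Qed.

(** * Averages over the Bloch sphere *)

Lemma continuous_derivable (f df : R -> R) :
  (forall x : R, is_derive x 1 f (df x)) -> continuous f.
Proof.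
by move=> d x; apply/differentiable_continuous/derivable1_diffP/ex_derive.
Qed.

Lemma Rintegral_FTC {f F : R -> R} {a b : R} : a < b ->
  continuous f -> (forall x : R, is_derive x 1 F (f x)) ->
  \int[@lebesgue_measure R]_(x in `[a, b]) f x = F b - F a.
Proof.
move=> ab cf dF; have cF := @continuous_derivable _ _ dF.
rewrite /Rintegral (@continuous_FTC2 _ f F)//.
- by apply: continuous_in_subspaceT => x _; exact: cf.
- split; first by move=> x _; exact: ex_derive.
  + by apply: cvg_at_right_filter; exact: cF.
  + by apply: cvg_at_left_filter; exact: cF.
- by move=> x _; rewrite derive1E; exact: derive_val.
Qed.

Lemma integral_polar (A B C : R) :
  \int[@lebesgue_measure R]_(x in `[0, pi])
     ((A + B * sin x ^+ 2 + C * cos x ^+ 2) * sin x) = 2 * A + 4 / 3 * B + 2 / 3 * C.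
Proof.
(* Under [u = cos x] the integrand becomes a quadratic polynomial in [u], whence the cubic
   primitive. *)
have dF (x : R) : is_derive x 1
    (fun x => - (A + B) * cos x + (B - C) / 3 * cos x ^+ 3)
    ((A + B * sin x ^+ 2 + C * cos x ^+ 2) * sin x).
  by apply: is_derive_eq; rewrite /GRing.scale /= sin2cos2; field.
have cf : continuous (fun x : R => (A + B * sin x ^+ 2 + C * cos x ^+ 2) * sin x).
  apply: (@continuous_derivable _ (fun x =>
    (2 * B * sin x * cos x - 2 * C * cos x * sin x) * sin x
      + (A + B * sin x ^+ 2 + C * cos x ^+ 2) * cos x)) => x.
  by apply: is_derive_eq; rewrite /GRing.scale /=; ring.
rewrite (Rintegral_FTC (pi_gt0 R) cf dF) cos0 cospi.
by field.
Qed.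

Lemma integral_azimuth (A B C : R) :
  \int[@lebesgue_measure R]_(x in `[0, 2 * pi])
     (A + B * sin x ^+ 2 + C * cos x ^+ 2) = pi * (2 * A + B + C).
Proof.
have dF (x : R) : is_derive x 1
    (fun x => (A + (B + C) / 2) * x + (C - B) / 2 * (sin x * cos x))
    (A + B * sin x ^+ 2 + C * cos x ^+ 2).
  have s2 : sin x * sin x = 1 - cos x ^+ 2 by rewrite -expr2 sin2cos2.
  by apply: is_derive_eq; rewrite /GRing.scale /=; field: s2.
have cf : continuous (fun x : R => A + B * sin x ^+ 2 + C * cos x ^+ 2).
  apply: (@continuous_derivable _ (fun x =>
    2 * B * sin x * cos x - 2 * C * cos x * sin x)) => x.
  by apply: is_derive_eq; rewrite /GRing.scale /=; ring.
have pi2 : (0 : R) < 2 * pi by rewrite mulr_gt0// pi_gt0.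
rewrite (Rintegral_FTC pi2 cf dF) sin0 mulr_natl sin2pi.
by field.
Qed.

(** Each squared coordinate of a uniform unit vector has mean 1/3; here this comes from integrating
    over [theta] and then over [phi]. *)
Lemma mean_bloch (g : 'cV[C]_2 -> R) (c x y z : R) :
  (forall theta phi, g (bloch theta phi) =
    c + x * (sin theta * cos phi) ^+ 2 + y * (sin theta * sin phi) ^+ 2
    + z * cos theta ^+ 2) ->
  mean_pure g = c + (x + y + z) / 3.
Proof.
move=> gE; rewrite /mean_pure.
under eq_Rintegral => phi _.
  under eq_Rintegral => theta _.
    rewrite gE (_ : _ * sin theta =
      (c + (x * cos phi ^+ 2 + y * sin phi ^+ 2) * sin theta ^+ 2
         + z * cos theta ^+ 2) * sin theta); last by ring.
    over.
  rewrite integral_polar (_ : _ + _ = (2 * c + 2 / 3 * z)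
    + (4 / 3 * y) * sin phi ^+ 2 + (4 / 3 * x) * cos phi ^+ 2); last by ring.
  over.
have pi0 : pi != 0 :> R by rewrite lt0r_neq0// pi_gt0.
by rewrite integral_azimuth; move: pi pi0 => p p0; field.
Qed.

(** * Positive semidefinite matrices of rank one *)

Lemma psdmx_ketbra n (v : 'cV[C]_n) : psdmx (ketbra v).
Proof.
move=> x; rewrite /ketbra mulmxA -mulmxA -[adjmx v *m x]adjmxK adjmxM adjmxK.
by rewrite mxE big_ord1 adjmxE mulcJ_ge0.
Qed.

(* For a form that is real on the diagonal, [a] and [b] are its values at (x, y)
   and (y, x); the hypotheses are its reality at x + iy and at x + y. *)
Lemma conj_polarization (I x y a b a' b' : C) : I != 0 ->
  x + - I * I * y + - I * a' + I * b' = x + - I * I * y + I * a + - I * b ->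
  x + y + a' + b' = x + y + a + b ->
  a' = b.
Proof.
move=> I0 h1 h2; apply/eqP; rewrite -subr_eq0 -(mulrI_eq0 _ (mulfI I0)).
have two : 2 != 0 :> C by rewrite pnatr_eq0.
rewrite -(mulrI_eq0 _ (mulfI two)); apply/eqP.
transitivity (I * (x + y + a' + b') - (x + - I * I * y + - I * a' + I * b')
   - (I * (x + y + a + b) - (x + - I * I * y + I * a + - I * b))).
  by ring.
by rewrite h1 h2 subrr.
Qed.

(** A positive form is real at every vector; polarisation along x + y and x + iy then shows that
    conjugation swaps its two arguments. *)
Lemma psdmx_herm n (A : 'M[C]_n) : psdmx A -> adjmx A = A.
Proof.
move=> psdA.
have real_form (v : 'cV[C]_n) :
    conjc ((adjmx v *m A *m v) 0 0) = (adjmx v *m A *m v) 0 0.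
  by have := ger0_Im (psdA v); case: (_ 0 0) => a b /= ->; rewrite oppr0.
pose f (x y : 'cV[C]_n) := (adjmx x *m A *m y) 0 0.
have fD (x y : 'cV[C]_n) (s : C) : f (x + s *: y) (x + s *: y) =
    f x x + conjc s * s * f y y + s * f x y + conjc s * f y x.
  rewrite /f (_ : adjmx (x + s *: y) = adjmx x + conjc s *: adjmx y); last first.
    by apply/matrixP => i j; rewrite !mxE conjcD conjcM.
  rewrite !mulmxDl !mulmxDr -!scalemxAr -!scalemxAl.
  rewrite ![(_ + _ : 'M[C]_1) 0 0]mxE ![(_ *: _ : 'M[C]_1) 0 0]mxE; ring.
have fJ x y : conjc (f x y) = f y x.
  have i0 : 'i%C != 0 :> C by rewrite eq_complex /= oner_eq0 andbF.
  have h s : conjc (f x x + conjc s * s * f y y + s * f x y + conjc s * f y x) =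
     f x x + conjc s * s * f y y + s * f x y + conjc s * f y x.
    by rewrite -fD; exact: real_form.
  have rf z : conjc (f z z) = f z z by exact: real_form.
  apply: (conj_polarization 'i%C (f x x) (f y y) (f x y) (f y x) _ (conjc (f y x))) => //.
    have := h 'i%C; rewrite !conjcD !conjcM !conjcK !rf conjci.
    by rewrite ['i%C * - 'i%C]mulrC.
  by have := h 1; rewrite conjc1 !mul1r !conjcD !rf.
apply/matrixP => i j; rewrite adjmxE.
have fE k l : f (delta_mx k 0) (delta_mx l 0) = A k l.
  rewrite /f (_ : adjmx _ = delta_mx 0 k) -?rowE -?colE ?mxE//.
  by apply/matrixP => p q; rewrite !mxE andbC conjc_nat.
by rewrite -!fE fJ.
Qed.

(** Rank one factors [A] as a column times a row. Hermitian symmetry makes the column a multiple of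
    the adjoint of the row, and positivity makes the multiplier a nonnegative real, whose square
    root is absorbed. *)
Lemma rank1_psd_ketbra n (A : 'M[C]_n) : psdmx A -> \rank A = 1%N ->
  exists v : 'cV[C]_n, A = ketbra v.
Proof.
move=> psdA rA; have hA := psdmx_herm _ A psdA.
have [u [v Auv]] : exists u : 'cV[C]_n, exists v : 'rV[C]_n, A = u *m v.
  have := mulmx_base A; move: (col_base A) (row_base A); rewrite rA => u v <-.
  by exists u, v.
have v0 : v != 0.
  by apply/eqP => v0; move: rA; rewrite Auv v0 mulmx0 mxrank0.
have nv (w : 'rV[C]_n) : (w *m adjmx w) 0 0 = \sum_i `|w 0 i| ^+ 2.
  by rewrite mxE; apply: eq_bigr => i _; rewrite adjmxE sqr_normc.
have nv0 : 0 < (v *m adjmx v) 0 0.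
  rewrite nv lt_neqAle sumr_ge0 ?andbT; last by move=> i _; rewrite exprn_ge0.
  apply: contra v0; rewrite eq_sym psumr_eq0; last by move=> i _; rewrite exprn_ge0.
  move=> /allP h; apply/eqP/rowP => i; rewrite mxE; apply/eqP.
  by have := h i (mem_index_enum _); rewrite sqrf_eq0 normr_eq0.
set N := (v *m adjmx v) 0 0 in nv0.
have Nm : v *m adjmx v = N%:M by rewrite [LHS]mx11_scalar.
(* Comparing [A] and its adjoint on the vector [adjmx v] forces this constant. *)
pose c := (adjmx u *m adjmx v) 0 0 / N.
have uE : u = c *: adjmx v.
  have : adjmx A *m adjmx v = A *m adjmx v by rewrite hA.
  rewrite Auv adjmxM -!mulmxA Nm [adjmx u *m _]mx11_scalar !mul_mx_scalar.
  move=> h; rewrite /c mulrC -scalerA h scalerA mulVf ?scale1r//.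
  by rewrite gt_eqF.
have c0 : 0 <= c.
  (* The form of [A] at [adjmx v] equals [c] times the square of [N]. *)
  have := psdA (adjmx v); rewrite adjmxK Auv uE.
  rewrite -scalemxAl -scalemxAr -scalemxAl mulmxA Nm -mulmxA Nm.
  rewrite mul_scalar_mx !mxE /= !mulr1n.
  by rewrite pmulr_lge0// mulr_gt0.
have [r r0 cr] : exists2 r : R, 0 <= r & c = r%:C.
  move: c0; case: (c) => a b; rewrite lecE /= => /andP[/eqP -> a0]; exists a => //.
exists ((Num.sqrt r)%:C *: adjmx v).
rewrite Auv uE /ketbra -!scalemxAl.
have -> : adjmx ((Num.sqrt r)%:C *: adjmx v) = (Num.sqrt r)%:C *: v.
  by apply/matrixP => i j; rewrite !mxE conjcM conjcK conjc_real.
by rewrite -scalemxAr scalerA -rmorphM -expr2 sqr_sqrtr// cr.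
Qed.

(** * The Choi state of a trace-preserving map *)

Lemma id_tensE k n (L : 'M[C]_n -> 'M[C]_n) (A : 'M[C]_(k * n)) a i b j :
  id_tens L A (mxtens_index (a, i)) (mxtens_index (b, j)) = L (sub_block A a b) i j.
Proof.
rewrite summxE (bigD1 a)//= [X in _ + X]big1 ?addr0 => [|c ca]; last first.
  rewrite summxE big1// => d _.
  by rewrite tensmxE mxE eq_sym (negPf ca) mul0r.
rewrite summxE (bigD1 b)//= [X in _ + X]big1 ?addr0 => [|d db]; last first.
  by rewrite tensmxE mxE [b == _]eq_sym (negPf db) andbF mul0r.
by rewrite tensmxE mxE !eqxx mul1r.
Qed.

Lemma Phi1E (a i : 'I_2) :
  Phi1 (mxtens_index (a, i)) 0 = ((Num.sqrt 2)^-1)%:C * (a == i)%:R :> C.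
Proof.
have indE (x y z t : 'I_2) : (mxtens_index (x, y) == mxtens_index (z, t)) = ((x, y) == (z, t)).
  exact: (inj_eq (can_inj (@mxtens_indexK 2 2))).
rewrite !mxE !indE !xpair_eqE !eqxx !andbT.
by case: a => [[|[|//]] ?]; case: i => [[|[|//]] ?]; rewrite /= ?(addr0, add0r).
Qed.

(** Trace preservation leaves the reduced state of the first qubit as it is in [Phi1]: half the
    identity. *)
Lemma choi_block_trace (L : {linear 'M[C]_2 -> 'M[C]_2}) (a b : 'I_2) :
  trace_preserving L ->
  \sum_(i < 2) choi_state L (mxtens_index (a, i)) (mxtens_index (b, i)) =
  2^-1 * (a == b)%:R.
Proof.
move=> tpL; transitivity (\tr (L (sub_block (ketbra (@Phi1 R)) a b))).
  by apply: eq_bigr => i _; rewrite id_tensE.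
rewrite tpL; transitivity (\sum_(i < 2) (2^-1 : C) * ((a == i)%:R * (b == i)%:R)).
  apply: eq_bigr => i _.
  rewrite [sub_block _ _ _ _ _]mxE ketbraE !Phi1E conjcM conjc_real conjc_nat.
  by rewrite mulrACA invsqrt2_sqr.
rewrite (bigD1 a)//= big1 ?eqxx ?mul1r ?addr0 1?eq_sym// => i ia.
by rewrite eq_sym (negPf ia) mul0r mulr0.
Qed.

(** * Local unitaries on two qubits *)

Lemma tensmx11 m n : 1%:M *t 1%:M = 1%:M :> 'M[C]_(m * n).
Proof.
apply/matrixP => k l; case: (mxtens_indexP k) => i j; case: (mxtens_indexP l) => i' j'.
rewrite tensmxE !mxE (inj_eq (can_inj (@mxtens_indexK m n))) xpair_eqE.
by case: eqP; case: eqP; rewrite ?mulr0 ?mulr1.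
Qed.

Lemma adjmx_tens m n p q (A : 'M[C]_(m, n)) (B : 'M[C]_(p, q)) :
  adjmx (A *t B) = adjmx A *t adjmx B.
Proof. by rewrite /adjmx trmx_tens map_mxT. Qed.

Lemma unitary1 n : unitary (1%:M : 'M[C]_n).
Proof. by rewrite /unitary /adjmx trmx1 map_mx1 mulmx1. Qed.

Lemma mxtrace_local_conj (U V : 'M[C]_2) rho : unitary U -> unitary V ->
  \tr (local_conj U V rho) = \tr rho.
Proof.
move=> /mulmx1C uU /mulmx1C uV.
by rewrite /local_conj mxtrace_mulC mulmxA adjmx_tens tensmx_mul uU uV tensmx11 mul1mx.
Qed.

Lemma local_conj_ketbra (U V : 'M[C]_2) v :
  local_conj U V (ketbra v) = ketbra ((U *t V) *m v).
Proof. by rewrite /local_conj /ketbra adjmxM !mulmxA. Qed.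

Lemma ketbraZ n (s : C) (v : 'cV[C]_n) : ketbra (s *: v) = (s * conjc s) *: ketbra v.
Proof. by apply/matrixP => i j; rewrite !mxE !big_ord1 !mxE conjcM mulrACA. Qed.

(** * Average and spread of the fidelity *)

Lemma bloch_vectorE (theta phi : R) : let psi := bloch theta phi in
  ((adjmx psi *m psi) 0 0 = 1) *
  ((adjmx psi *m sigma R (o3 0) *m psi) 0 0 = (sin theta * cos phi)%:C) *
  ((adjmx psi *m sigma R (o3 1) *m psi) 0 0 = (sin theta * sin phi)%:C) *
  ((adjmx psi *m sigma R (o3 2) *m psi) 0 0 = (cos theta)%:C).
Proof.
move=> psi.
(* In terms of [theta / 2] and [phi], only the Pythagorean relations of these two angles remain to
   be used. *)
have half : theta = (theta / 2) *+ 2 by field.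
have sE : sin theta = 2 * (cos (theta / 2) * sin (theta / 2)).
  by rewrite {1}half sin_mulr2n mulr_natl.
have cE : cos theta = 2 * (cos (theta / 2) * cos (theta / 2)) - 1.
  by rewrite {1}half cos_mulr2n -expr2 mulr_natl.
have hs : sin (theta / 2) * sin (theta / 2) = 1 - cos (theta / 2) * cos (theta / 2).
  by rewrite -!expr2 sin2cos2.
have hp : sin phi * sin phi = 1 - cos phi * cos phi by rewrite -!expr2 sin2cos2.
do ?split; rewrite ?sandwichE ?sigmaE ?mx22E ?sE ?cE.
all: rewrite ?(sum2, mxE); apply/eqP; rewrite eq_complex /=.
all: by apply/andP; split; apply/eqP; ring: hs hp.
Qed.

Lemma fidelity_bloch rho (theta phi : R) :
  let T := corr_mx rho in
  fidelity rho (bloch theta phi) = 2^-1 * (complex.Re (\tr rho)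
    - (T (o3 0) (o3 0) * (sin theta * cos phi) ^+ 2
     + T (o3 1) (o3 1) * (sin theta * sin phi) ^+ 2
     + T (o3 2) (o3 2) * cos theta ^+ 2)).
Proof.
move=> T; rewrite /fidelity fidelity_sumE sum3 !bloch_vectorE !mxE.
have -> : 2^-1 = (2^-1)%:C :> C by rewrite fmorphV rmorphMn.
rewrite expr1n mul1r -!rmorphXn.
case: (\tr rho) => r r'.
case: (\tr _) => x x'; case: (\tr _) => y y'; case: (\tr _) => z z' /=.
by ring.
Qed.

Lemma avg_fidelityE rho : avg_fidelity rho =
  2^-1 * (complex.Re (\tr rho) - (\sum_i corr_mx rho i i) / 3).
Proof.
rewrite /avg_fidelity sum3; set T := corr_mx rho.
rewrite (mean_bloch _ (2^-1 * complex.Re (\tr rho))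
  (- 2^-1 * T (o3 0) (o3 0))
  (- 2^-1 * T (o3 1) (o3 1))
  (- 2^-1 * T (o3 2) (o3 2))).
  by field.
by move=> theta phi; rewrite fidelity_bloch -/T; ring.
Qed.

(** The fidelity at a Bloch vector n is (1 + |n|^2) / 2 = 1, so the integrand of the variance
    vanishes identically. *)
Lemma sd_fidelity_antipodal rho : complex.Re (\tr rho) = 1 ->
  (forall i, corr_mx rho i i = -1) -> sd_fidelity rho = 0.
Proof.
move=> tr1 TN1; rewrite /sd_fidelity (mean_bloch _ 0 0 0 0).
  by rewrite !addr0 mul0r addr0 sqrtr0.
move=> theta phi; rewrite fidelity_bloch avg_fidelityE sum3 !TN1 tr1.
have hp : sin phi * sin phi = 1 - cos phi * cos phi by rewrite -!expr2 sin2cos2.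
have ht : sin theta * sin theta = 1 - cos theta * cos theta by rewrite -!expr2 sin2cos2.
by field: hp ht.
Qed.

(** The eigenvalues of [sigma R i *t sigma R i] are 1 and -1; in coordinates the difference of the
    two sides is a sum of squares. *)
Lemma corr_mx_ketbra_ge (v : 'cV[C]_(2 * 2)) i :
  - complex.Re (\tr (ketbra v)) <= corr_mx (ketbra v) i i.
Proof.
rewrite mxE mxtrace_tens mxtrace_tensmx !sum2 !ketbraE.
move: (v _ 0) (v _ 0) (v _ 0) (v _ 0) => [a a'] [b b'] [c c'] [d d'].
rewrite -subr_ge0; move: i; apply: ord3P; rewrite sigmaE !mx22E /=;
  set x := (X in 0 <= X).
- have -> : x = (a + d) ^+ 2 + (a' + d') ^+ 2 + (b + c) ^+ 2 + (b' + c') ^+ 2.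
    by rewrite /x; ring.
  by rewrite !addr_ge0 ?sqr_ge0.
- have -> : x = (a - d) ^+ 2 + (a' - d') ^+ 2 + (b + c) ^+ 2 + (b' + c') ^+ 2.
    by rewrite /x; ring.
  by rewrite !addr_ge0 ?sqr_ge0.
- have -> : x = 2 * (a ^+ 2 + a' ^+ 2 + d ^+ 2 + d' ^+ 2) by rewrite /x; ring.
  by rewrite mulr_ge0// !addr_ge0 ?sqr_ge0.
Qed.

(** Bounds the set whose supremum defines [max_avg_fidelity]. *)
Lemma avg_fidelity_ketbra_le (v : 'cV[C]_(2 * 2)) :
  avg_fidelity (ketbra v) <= complex.Re (\tr (ketbra v)).
Proof.
have h i := corr_mx_ketbra_ge v i.
rewrite avg_fidelityE sum3.
have := h (o3 0); have := h (o3 1); have := h (o3 2).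
by lra.
Qed.

(** * Normal form of the amplitudes *)

(** The amplitude matrix, with rows indexed by the first qubit, is a real multiple of an element of
    SU(2). *)
Definition su2_ket (p q : C) : 'cV[C]_(2 * 2) :=
  \col_k let: (a, i) := mxtens_unindex k in mx22 p q (- conjc q) (conjc p) a i.

Lemma su2_ketE p q (a i : 'I_2) :
  su2_ket p q (mxtens_index (a, i)) 0 = mx22 p q (- conjc q) (conjc p) a i.
Proof. by rewrite mxE mxtens_indexK. Qed.

Lemma colP2 (v w : 'cV[C]_(2 * 2)) :
  (forall a i : 'I_2, v (mxtens_index (a, i)) 0 = w (mxtens_index (a, i)) 0) -> v = w.
Proof. by move=> h; apply/colP => k; case: (mxtens_indexP k). Qed.

(** By hypothesis the rows of the amplitude matrix of [w] are orthogonal of squared norm 1/2, so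
    sqrt 2 times it is unitary. Its determinant is a phase [mu]; dividing by a square root of [mu]
    lands in SU(2). *)
Lemma ketbra_su2 (w : 'cV[C]_(2 * 2)) :
  (forall a b : 'I_2, \sum_(i < 2) ketbra w (mxtens_index (a, i)) (mxtens_index (b, i))
     = 2^-1 * (a == b)%:R) ->
  exists p q, p * conjc p + q * conjc q = 2^-1 /\ ketbra w = ketbra (su2_ket p q).
Proof.
move=> h; have := h 0 0; have := h 1 1; have := h 1 0; have := h 0 1.
rewrite !sum2 !ketbraE /= !mulr1 !mulr0.
set a := w (mxtens_index (0, 0)) 0; set b := w (mxtens_index (0, 1)) 0.
set c := w (mxtens_index (1, 0)) 0; set d := w (mxtens_index (1, 1)) 0.
move=> o1 o2 n2 n1.
have two : 2 != 0 :> C by rewrite pnatr_eq0.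
have n1' : 2 * (a * conjc a + b * conjc b) = 1 by rewrite n1 mulfV.
(* Row (c, d) is orthogonal to (a, b), hence a multiple of (- b^*, a^* ); a square
   root of the factor mu gives the global phase. *)
pose mu := 2 * (a * d - b * c).
have cE : c = - mu * conjc b.
  rewrite -[LHS]mulr1 -n1' /mu.
  by transitivity (- (2 * (a * d - b * c)) * conjc b
      + 2 * a * (c * conjc a + d * conjc b)); [ring | rewrite o2; ring].
have dE : d = mu * conjc a.
  rewrite -[LHS]mulr1 -n1' /mu.
  by transitivity ((2 * (a * d - b * c)) * conjc a
      + 2 * b * (c * conjc a + d * conjc b)); [ring | rewrite o2; ring].
clearbody mu.
pose nu := sqrtc mu; have nu2 : nu * nu = mu by rewrite -expr2 sqr_sqrtc.
clearbody nu.
(* The two rows have equal norms, so [mu] has modulus one. *)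
have mumu : mu * conjc mu = 1.
  transitivity (mu * conjc mu * (2 * (a * conjc a + b * conjc b))).
    by rewrite n1' mulr1.
  transitivity (2 * (c * conjc c + d * conjc d)); last by rewrite n2 mulfV.
  by rewrite cE dE !conjcM conjcN !conjcK; ring.
have nunu : nu * conjc nu = 1.
  have n0 := mulcJ_ge0 nu.
  apply/eqP; rewrite -(@pexpr_eq1 _ _ 2) //.
  by rewrite expr2 mulrACA -conjcM nu2 mumu.
exists (conjc nu * a), (conjc nu * b); split.
  rewrite !conjcM conjcK -n1.
  transitivity (nu * conjc nu * (a * conjc a + b * conjc b)); first by ring.
  by rewrite nunu mul1r.
have -> : w = nu *: su2_ket (conjc nu * a) (conjc nu * b).
  apply: colP2; apply: ord2P; apply: ord2P; rewrite mxE su2_ketE mx22E -/a -/b -/c -/d.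
  - by rewrite mulrA nunu mul1r.
  - by rewrite mulrA nunu mul1r.
  - by rewrite cE conjcM conjcK -nu2; ring.
  - by rewrite dE conjcM conjcK -nu2; ring.
by rewrite ketbraZ nunu scale1r.
Qed.

Lemma singlet_su2 : @singlet R = su2_ket 0 ((Num.sqrt 2)^-1)%:C.
Proof.
apply: colP2; apply: ord2P; apply: ord2P; rewrite singletE su2_ketE mx22E //.
- by rewrite conjc_real.
- by rewrite conjc0.
Qed.

Lemma mxtrace_su2 {p q} : p * conjc p + q * conjc q = 2^-1 ->
  \tr (ketbra (su2_ket p q)) = 1.
Proof.
move=> n; rewrite mxtrace_tens !sum2 !ketbraE !su2_ketE !mx22E !conjcN !conjcK.
transitivity (2 * (p * conjc p + q * conjc q)); first by ring.
by rewrite n mulfV// pnatr_eq0.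
Qed.

(** * The correlation matrix of the normal form *)

Definition mx33 (a b c d e f g h i : R) : 'M[R]_3 :=
  \matrix_(k, l) nth 0 (nth [::] [:: [:: a; b; c]; [:: d; e; f]; [:: g; h; i]] k) l.

Lemma det_mx33 (a b c d e f g h i : R) : \det (mx33 a b c d e f g h i) =
  a * (e * i - f * h) - b * (d * i - f * g) + c * (d * h - e * g).
Proof.
rewrite (expand_det_row _ ord0) !big_ord_recl big_ord0 /cofactor.
rewrite !(expand_det_row _ ord0) !big_ord_recl !big_ord0 /cofactor !det_mx11.
by rewrite !mxE /=; ring.
Qed.

(** Minus this matrix is the Euler-Rodrigues matrix of the quaternion sqrt 2 (q, p', p, -q'), real
    part first. *)
Lemma corr_mx_su2E (p p' q q' : R) :
  corr_mx (ketbra (su2_ket (p +i* p') (q +i* q'))) =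
  mx33 (2 * (p * p - p' * p' - q * q + q' * q')) (- 4 * (p * p' + q * q'))
       (- 4 * (p * q - p' * q'))
       (- 4 * (p * p' - q * q')) (2 * (- (p * p) + p' * p' - q * q + q' * q'))
       (4 * (p' * q + p * q'))
       (4 * (p * q + p' * q')) (- 4 * (p' * q - p * q'))
       (2 * (p * p + p' * p' - q * q - q' * q')).
Proof.
apply/matrixP; apply: ord3P; apply: ord3P;
  rewrite mxE mxtrace_tensmx !sum2 !ketbraE !su2_ketE !sigmaE !mx22E /= mxE /=; ring.
Qed.

Lemma corr_mx_su2_orthogonal {p q : C} : p * conjc p + q * conjc q = 2^-1 ->
  let T := corr_mx (ketbra (su2_ket p q)) in T^T *m T = 1%:M /\ \det T = -1.
Proof.
case: p q => [p p'] [q q'] n.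
have {}n : 2 * (p * p + p' * p' + q * q + q' * q') = 1.
  have h : 2^-1 = (2^-1)%:C :> C by rewrite fmorphV rmorphMn.
  move: n; rewrite h => /eqP; rewrite eq_complex /= => /andP[/eqP n _].
  by transitivity (2 * 2^-1 : R); [rewrite -n; ring | rewrite mulfV].
(* The entries of [T^T *m T] have degree four, so each diagonal 1 is written as the square of a
   quadratic form; likewise the determinant below is minus its cube. *)
have n2 : 1 = (2 * (p * p + p' * p' + q * q + q' * q')) ^+ 2 by rewrite n expr1n.
rewrite /= corr_mx_su2E; split.
  apply/matrixP; apply: ord3P; apply: ord3P; rewrite !mxE sum3 !mxE /=;
    by [ring | rewrite [RHS]n2; ring].
rewrite det_mx33.
by transitivity (- (2 * (p * p + p' * p' + q * q + q' * q')) ^+ 3);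
  [ring | rewrite n expr1n].
Qed.

(** * Singular values of an orthogonal matrix *)

Lemma char_poly1 n : char_poly (1%:M : 'M[R]_n) = \prod_(k < n) ('X - 1%:P).
Proof.
rewrite char_poly_trig ?scalar_mx_is_trig//.
by apply: eq_bigr => i _; rewrite mxE eqxx.
Qed.

Lemma singular_values_orthogonal (T : 'M[R]_3) t :
  T^T *m T = 1%:M -> singular_values T t -> forall k, t k = 1.
Proof.
move=> TT [t0]; rewrite TT char_poly1 => cp k.
(* At [t k ^+ 2] the right-hand product vanishes, leaving (t_k^2 - 1)^3 = 0. *)
have := congr1 (fun f => f.[t k ^+ 2]) cp.
rewrite !horner_prod [RHS](bigD1 k)//= !hornerXsubC subrr mul0r prodr_const => /eqP.
rewrite expf_eq0 card_ord /= subr_eq0 sqrf_eq1 => /orP[/eqP//|/eqP tN1].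
by have := t0 k; rewrite tN1 oppr_ge0 ler10.
Qed.

Lemma singular_values_cst1 (T : 'M[R]_3) :
  T^T *m T = 1%:M -> singular_values T (fun=> 1).
Proof.
move=> TT; split=> //; rewrite TT char_poly1.
by apply: eq_bigr => i _; rewrite expr1n.
Qed.

(** * Reduction to the singlet *)

Lemma singlet_correction {p q : C} : p * conjc p + q * conjc q = 2^-1 ->
  exists V : 'M[C]_2, unitary V /\
    (1%:M *t V) *m su2_ket p q = singlet.
Proof.
move=> n; pose s : C := (Num.sqrt 2)%:C.
have ss : s * s = 2 by rewrite /s -rmorphM -expr2 sqr_sqrtr// rmorphMn.
have sJ : conjc s = s by exact: conjc_real.
have two : 2 != 0 :> C by rewrite pnatr_eq0.
have sV : s * 2^-1 = ((Num.sqrt 2)^-1)%:C.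
  rewrite fmorphV -/s -ss invfM mulrA mulfV ?mul1r//.
  by apply: contra_eq_neq ss => ->; rewrite mul0r eq_sym.
(* With A the amplitude matrix and J that of the singlet, the condition is A V^T = J. The inverse of
   A is twice its adjoint, which determines this V. *)
exists (s *: mx22 q (- p) (conjc p) (conjc q)); split.
  apply/matrixP; apply: ord2P; apply: ord2P;
    rewrite mulmx22E !adjmxE !mxE /= ?(conjcM, conjcN, conjcK) sJ.
  - transitivity (s * s * (p * conjc p + q * conjc q)); first by ring.
    by rewrite ss n mulfV.
  - by ring.
  - by ring.
  - transitivity (s * s * (p * conjc p + q * conjc q)); first by ring.
    by rewrite ss n mulfV.
apply: colP2; apply: ord2P; apply: ord2P;
  rewrite singletE mxE sum_mxtens !sum2 !tensmxE !su2_ketE !mxE /=.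
- by ring.
- by rewrite -sV -n; ring.
- by rewrite -sV -n; ring.
- by ring.
Qed.

Lemma corr_mx_singlet : corr_mx (ketbra (@singlet R)) = diag_mx (\row_k (-1)).
Proof.
rewrite singlet_su2 corr_mx_su2E.
have s2 : (Num.sqrt 2 : R)^-1 * (Num.sqrt 2)^-1 = 2^-1.
  by rewrite -invfM -expr2 sqr_sqrtr.
move: (_^-1) s2 => s s2.
apply/matrixP; apply: ord3P; apply: ord3P; rewrite !mxE /= ?mulr0n ?mulr1n; lra.
Qed.

(** * Usefulness of the shared state *)

Lemma choi_normal_form (L : {linear 'M[C]_2 -> 'M[C]_2}) : qubit_channel L ->
  \rank (choi_state L) = 1%N ->
  exists p q, p * conjc p + q * conjc q = 2^-1 /\ choi_state L = ketbra (su2_ket p q).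
Proof.
(* Complete positivity with a two-dimensional ancilla, applied to the projector on [Phi1], makes the
   Choi state positive. *)
move=> [cpL tpL] /(rank1_psd_ketbra _ _ (cpL _ _ (psdmx_ketbra _ _))) [w wE].
have [a b|p [q [n pqE]]] := ketbra_su2 w.
  by move: wE; rewrite -/(choi_state _) => <-; exact: choi_block_trace.
by exists p, q; rewrite -pqE -wE.
Qed.

(** The local unitary [1%:M *t V] reaches the singlet, whose average fidelity is 1; boundedness of
    the set makes its [sup] dominate this value. *)
Lemma max_avg_fidelity_ge1 {v} {V : 'M[C]_2} : unitary V ->
  (1%:M *t V) *m v = @singlet R -> \tr (ketbra v) = 1 ->
  1 <= max_avg_fidelity (ketbra v).
Proof.
move=> uV VE tr1; apply: ub_le_sup.
  exists 1 => _ [U [W [uU uW ->]]].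
  have <- : complex.Re (\tr (local_conj U W (ketbra v))) = 1.
    by rewrite mxtrace_local_conj// tr1.
  by rewrite local_conj_ketbra; exact: avg_fidelity_ketbra_le.
have u1 := unitary1 2.
exists 1%:M, V; split=> //.
rewrite avg_fidelityE mxtrace_local_conj// tr1 local_conj_ketbra VE corr_mx_singlet.
by rewrite sum3 !mxE /= !mulr1n; lra.
Qed.

(** The singlet shows that a canonical form exists. The one chosen by [xget] is unspecified, but
    signs -1 and singular values 1 force its correlation matrix to be minus the identity. *)
Lemma fidelity_deviation_eq0 {v} {V : 'M[C]_2} : unitary V ->
  (1%:M *t V) *m v = @singlet R -> \tr (ketbra v) = 1 ->
  let T := corr_mx (ketbra v) in T^T *m T = 1%:M -> \det T = -1 ->
  fidelity_deviation (ketbra v) = 0.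
Proof.
move=> uV VE tr1 T TT detT; rewrite /fidelity_deviation.
set rhoC := Defs.canonical_form _.
have u1 := unitary1 2.
have signs t (lambda : 'I_3 -> R) : canonical_signs T t lambda <-> forall k, lambda k = -1.
  by rewrite /canonical_signs detT oppr_le0 ler01.
have canV : is_canonical_form (ketbra v) (ketbra singlet).
  split; first by exists 1%:M, V; split=> //; rewrite local_conj_ketbra VE.
  exists (fun=> 1), (fun=> -1); split.
  - exact: singular_values_cst1.
  - exact/signs.
  - by rewrite corr_mx_singlet mulr1.
have : is_canonical_form (ketbra v) rhoC
  by exact: xgetPex (ex_intro _ _ canV).
move=> [[U [W [uU uW rhoCE]]]].
move=> [t [lambda [sv /signs lN1 cE]]].
apply: sd_fidelity_antipodal; first by rewrite rhoCE mxtrace_local_conj// tr1.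
move=> i; rewrite cE !mxE eqxx lN1.
by rewrite (singular_values_orthogonal _ _ TT sv) mulr1 mulr1n.
Qed.

End RankOneChoi.

Theorem proposition1 (R : realType)
    (Lam : {linear 'M[R[i]]_2 -> 'M[R[i]]_2}) :
  qubit_channel Lam ->
  \rank (choi_state Lam) = 1%N ->
  useful_for_UQT (id_tens Lam (ketbra (@Phi1 R))).
Proof.
move=> chL rL; have [p [q [n rhoE]]] := choi_normal_form _ _ chL rL.
have [V [uV VE]] := singlet_correction _ n.
have tr1 := mxtrace_su2 _ n; have [TT detT] := corr_mx_su2_orthogonal _ n.
rewrite -/(choi_state _) rhoE; split; last exact: (fidelity_deviation_eq0 _ uV).
by apply: lt_le_trans (max_avg_fidelity_ge1 _ uV VE tr1); lra.
Qed.
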